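(* Let $(\mathfrak g,[\cdot,\cdot]_{\mathfrak g},[\![\cdot,\cdot,\cdot]\!]_{\mathfrak g})$ and $(\mathfrak h,[\cdot,\cdot]_{\mathfrak h},[\![\cdot,\cdot,\cdot]\!]_{\mathfrak h})$ be Lie-Yamaguti algebras and $T:\mathfrak h\to\mathfrak g$ a relative Rota-Baxter operator of weight $1$ with respect to an action $(\rho,\mu)$ of $\mathfrak g$ on $\mathfrak h$. Define $\rho_T:\mathfrak h\to\mathfrak{gl}(\mathfrak g)$, $\mu_T:\otimes^2\mathfrak h\to\mathfrak{gl}(\mathfrak g)$ and $D_T:\wedge^2\mathfrak h\to\mathfrak{gl}(\mathfrak g)$ by, for $u,v\in\mathfrak h$, $x\in\mathfrak g$, $$\rho_T(u)(x)=[Tu,x]_{\mathfrak g}+T(\rho(x)u),$$ $$\mu_T(u,v)(x)=[\![x,Tu,Tv]\!]_{\mathfrak g}-T\big(D(x,Tu)v-\mu(x,Tv)u\big),$$ $$D_T(u,v)(x)=[\![Tu,Tv,x]\!]_{\mathfrak g}-T\big(\mu(Tv,x)u-\mu(Tu,x)v\big).$$ Then $(\mathfrak g;\rho_T,\mu_T)$ (with associated map $D_{\rho_T,\mu_T}=D_T$) is a representation of the descent Lie-Yamaguti algebra $(\mathfrak h,[\cdot,\cdot]_T,[\![\cdot,\cdot,\cdot]\!]_T)$.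
   Context: All vector spaces are finite-dimensional over a field $\mathbb K$ of characteristic $0$. **Lie-Yamaguti algebra**: a vector space $\mathfrak g$ with a bilinear bracket $[\cdot,\cdot]:\wedge^2\mathfrak g\to\mathfrak g$ and a trilinear bracket $[\![\cdot,\cdot,\cdot]\!]:\wedge^2\mathfrak g\otimes\mathfrak g\to\mathfrak g$ (skew-symmetric in the first two arguments) such that for all $x,y,z,w,t$: (LY1) $[[x,y],z]+[[y,z],x]+[[z,x],y]+[\![x,y,z]\!]+[\![y,z,x]\!]+[\![z,x,y]\!]=0$; (LY2) $[\![[x,y],z,w]\!]+[\![[y,z],x,w]\!]+[\![[z,x],y,w]\!]=0$; (LY3) $[\![x,y,[z,w]]\!]=[[\![x,y,z]\!],w]+[z,[\![x,y,w]\!]]$; (LY4) $[\![x,y,[\![z,w,t]\!]]\!]=[\![[\![x,y,z]\!],w,t]\!]+[\![z,[\![x,y,w]\!],t]\!]+[\![z,w,[\![x,y,t]\!]]\!]$. **Representation** of $\mathfrak g$: a vector space $V$ with linear $\rho:\mathfrak g\to\mathfrak{gl}(V)$ and bilinear $\mu:\otimes^2\mathfrak g\to\mathfrak{gl}(V)$ such that for all $x,y,z,w\in\mathfrak g$: $\mu([x,y],z)-\mu(x,z)\rho(y)+\mu(y,z)\rho(x)=0$; $\mu(x,[y,z])-\rho(y)\mu(x,z)+\rho(z)\mu(x,y)=0$; $\rho([\![x,y,z]\!])=[D(x,y),\rho(z)]$; $\mu(z,w)\mu(x,y)-\mu(y,w)\mu(x,z)-\mu(x,[\![y,z,w]\!])+D(y,z)\mu(x,w)=0$;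 $\mu([\![x,y,z]\!],w)+\mu(z,[\![x,y,w]\!])=[D(x,y),\mu(z,w)]$; where $D(x,y)=D_{\rho,\mu}(x,y):=\mu(y,x)-\mu(x,y)+[\rho(x),\rho(y)]-\rho([x,y])$. **Center** of a Lie-Yamaguti algebra $\mathfrak h$: $C(\mathfrak h)=\{x\in\mathfrak h: [x,y]=0,\ [\![x,y,z]\!]=0,\ [\![y,z,x]\!]=0\ \ \forall y,z\in\mathfrak h\}$. **Action** of $\mathfrak g$ on a Lie-Yamaguti algebra $(\mathfrak h,[\cdot,\cdot]_{\mathfrak h},[\![\cdot,\cdot,\cdot]\!]_{\mathfrak h})$: a pair $(\rho,\mu)$ such that $(\mathfrak h;\rho,\mu)$ is a representation of $\mathfrak g$ and for all $x,y\in\mathfrak g$, $u,v,w\in\mathfrak h$: $\rho(x)u,\ \mu(x,y)u\in C(\mathfrak h)$; $\rho(x)[u,v]_{\mathfrak h}=\mu(x,y)[u,v]_{\mathfrak h}=0$; $\rho(x)[\![u,v,w]\!]_{\mathfrak h}=\mu(x,y)[\![u,v,w]\!]_{\mathfrak h}=0$. **Relative Rota-Baxter operator of weight $1$** from $\mathfrak h$ to $\mathfrak g$ with respect to an action $(\rho,\mu)$ of $\mathfrak g$ on $\mathfrak h$: a linear map $T:\mathfrak h\to\mathfrak g$ such that for all $u,v,w\in\mathfrak h$ $[Tu,Tv]_{\mathfrak g}=T(\rho(Tu)v-\rho(Tv)u+[u,v]_{\mathfrak h})$, $[\![Tu,Tv,Tw]\!]_{\mathfrak g}=T(D(Tu,Tv)w+\mu(Tv,Tw)u-\mu(Tu,Tw)v+[\![u,v,w]\!]_{\mathfrak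 h})$. **Descent Lie-Yamaguti algebra** of such a $T$: the space $\mathfrak h$ with the Lie-Yamaguti algebra structure $[u,v]_T=\rho(Tu)v-\rho(Tv)u+[u,v]_{\mathfrak h}$, $[\![u,v,w]\!]_T=D(Tu,Tv)w+\mu(Tv,Tw)u-\mu(Tu,Tw)v+[\![u,v,w]\!]_{\mathfrak h}$. *)

(* Defs.v *)
From mathcomp Require Import all_boot all_algebra.
From mathcomp Require Import ring.

Set Implicit Arguments.
Unset Strict Implicit.
Unset Printing Implicit Defensive.

Import GRing.Theory.
Local Open Scope ring_scope.

Record lieYamaguti (K : fieldType) (V : vectType K) := LieYamaguti {
  bra : V -> V -> V;
  tri : V -> V -> V -> V;
  bra_linearl : forall y, linear (fun x => bra x y);
  bra_linearr : forall x, linear (fun y => bra x y);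
  bra_skew : forall x y, bra x y = - bra y x;
  tri_linear1 : forall y z, linear (fun x => tri x y z);
  tri_linear2 : forall x z, linear (fun y => tri x y z);
  tri_linear3 : forall x y, linear (fun z => tri x y z);
  tri_skew : forall x y z, tri x y z = - tri y x z;
  LY1 : forall x y z,
    bra (bra x y) z + bra (bra y z) x + bra (bra z x) y
    + tri x y z + tri y z x + tri z x y = 0;
  LY2 : forall x y z w,
    tri (bra x y) z w + tri (bra y z) x w + tri (bra z x) y w = 0;
  LY3 : forall x y z w,
    tri x y (bra z w) = bra (tri x y z) w + bra z (tri x y w);
  LY4 : forall x y z w t,
    tri x y (tri z w t)
    = tri (tri x y z) w t + tri z (tri x y w) t + tri z w (tri x y t)
}.

Section Representation.
Variables (K : fieldType) (g : vectType K) (Lg : lieYamaguti g).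
Variables (V : vectType K) (rho : g -> V -> V) (mu : g -> g -> V -> V).

Definition repD (x y : g) (v : V) : V :=
  mu y x v - mu x y v + (rho x (rho y v) - rho y (rho x v))
  - rho (bra Lg x y) v.

(* The identities in gl(V) are stated pointwise; the linearity fields say that
   rho and mu are (bi)linear maps with values in gl(V). *)
Record is_representation : Prop := IsRepresentation {
  rho_linear : forall x, linear (rho x);
  rho_linear1 : forall v, linear (fun x => rho x v);
  mu_linear : forall x y, linear (mu x y);
  mu_linear1 : forall y v, linear (fun x => mu x y v);
  mu_linear2 : forall x v, linear (fun y => mu x y v);
  rep_mu_bral : forall x y z v,
    mu (bra Lg x y) z v - mu x z (rho y v) + mu y z (rho x v) = 0;
  rep_mu_brar : forall x y z v,
    mu x (bra Lg y z) v - rho y (mu x z v) + rho z (mu x y v) = 0;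
  rep_rho_tri : forall x y z v,
    rho (tri Lg x y z) v = repD x y (rho z v) - rho z (repD x y v);
  rep_mu_trir : forall x y z w v,
    mu z w (mu x y v) - mu y w (mu x z v) - mu x (tri Lg y z w) v
    + repD y z (mu x w v) = 0;
  rep_mu_D : forall x y z w v,
    mu (tri Lg x y z) w v + mu z (tri Lg x y w) v
    = repD x y (mu z w v) - mu z w (repD x y v)
}.

End Representation.

Definition in_center (K : fieldType) (h : vectType K) (Lh : lieYamaguti h)
    (x : h) : Prop :=
  forall y z, [/\ bra Lh x y = 0, tri Lh x y z = 0 & tri Lh y z x = 0].

Record is_action (K : fieldType) (g h : vectType K) (Lg : lieYamaguti g)
    (Lh : lieYamaguti h) (rho : g -> h -> h) (mu : g -> g -> h -> h) : Prop :=
  IsAction {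
  action_rep : is_representation Lg rho mu;
  action_rho_center : forall x u, in_center Lh (rho x u);
  action_mu_center : forall x y u, in_center Lh (mu x y u);
  action_rho_bra : forall x u v, rho x (bra Lh u v) = 0;
  action_mu_bra : forall x y u v, mu x y (bra Lh u v) = 0;
  action_rho_tri : forall x u v w, rho x (tri Lh u v w) = 0;
  action_mu_tri : forall x y u v w, mu x y (tri Lh u v w) = 0
}.

Section RelativeRotaBaxter.
Variables (K : fieldType) (g h : vectType K).
Variables (Lg : lieYamaguti g) (Lh : lieYamaguti h).
Variables (rho : g -> h -> h) (mu : g -> g -> h -> h) (T : 'Hom(h, g)).

Definition descent_bra (u v : h) : h :=
  rho (T u) v - rho (T v) u + bra Lh u v.

Definition descent_tri (u v w : h) : h :=
  repD Lg rho mu (T u) (T v) w + mu (T v) (T w) u - mu (T u) (T w) v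
  + tri Lh u v w.

Definition is_relative_rota_baxter1 : Prop :=
  (forall u v, bra Lg (T u) (T v) = T (descent_bra u v)) /\
  (forall u v w, tri Lg (T u) (T v) (T w) = T (descent_tri u v w)).

Definition rhoT (u : h) (x : g) : g := bra Lg (T u) x + T (rho x u).

Definition muT (u v : h) (x : g) : g :=
  tri Lg x (T u) (T v) - T (repD Lg rho mu x (T u) v - mu x (T v) u).

Definition DT (u v : h) (x : g) : g :=
  tri Lg (T u) (T v) x - T (mu (T v) x u - mu (T u) x v).

End RelativeRotaBaxter.

Lemma linear_rules (K : fieldType) (U V : vectType K) (f : U -> V) :
  linear f -> [/\ {morph f : x y / x + y}, {morph f : x / - x} & f 0 = 0].
Proof.
move=> lf; have f0 : f 0 = 0.
  by have := lf 1 0 0; rewrite !scale1r addr0 => /esym/(canRL (addrK _)); rewrite subrr.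
split=> // [x y|x]; first by have := lf 1 x y; rewrite !scale1r.
by have := lf (-1) x 0; rewrite f0 !addr0 !scaleN1r.
Qed.

(* Reduces an identity in V to identities between scalars, to which ring applies. *)
Lemma eq_coord (K : fieldType) (V : vectType K) (a b : V) :
  (forall f : V -> K, {morph f : x y / x + y} -> {morph f : x / - x} ->
     f 0 = 0 -> f a = f b) -> a = b.
Proof.
move=> e; rewrite (coord_vbasis (memvf a)) (coord_vbasis (memvf b)).
apply: eq_bigr => i _; congr (_ *: _).
by apply: (e (coord _ i)) => [x y|x|]; rewrite ?(linearD, linearN, linear0).
Qed.

Ltac vring := apply: eq_coord;
  let f := fresh "f" in let fD := fresh "fD" in let fN := fresh "fN" in
  let f0 := fresh "f0" in
  move=> f fD fN f0; rewrite ?(fD, fN, f0);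
  repeat match goal with |- context [f ?x] => move: (f x) => ? end;
  clear; ring.

(* An opaque copy of repD, so that rewriting does not unfold it. *)
Fact sealD_subproof (K : fieldType) (g : vectType K) (Lg : lieYamaguti g)
    (V : vectType K) (rho : g -> V -> V) (mu : g -> g -> V -> V) :
  {d | forall x y v, repD Lg rho mu x y v = d x y v}.
Proof. by exists (repD Lg rho mu). Qed.

Section Descent.
Variables (K : fieldType) (g h : vectType K).
Variables (Lg : lieYamaguti g) (Lh : lieYamaguti h).
Variables (rho : g -> h -> h) (mu : g -> g -> h -> h).
Hypothesis act : is_action Lg Lh rho mu.

Let rep := action_rep act.
Local Notation D := (sval (sealD_subproof Lg rho mu)).

Let sealE x y v : repD Lg rho mu x y v = D x y v.
Proof. exact: svalP (sealD_subproof Lg rho mu) x y v. Qed.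
Let DE x y v : D x y v = mu y x v - mu x y v
  + (rho x (rho y v) - rho y (rho x v)) - rho (bra Lg x y) v.
Proof. by rewrite -sealE. Qed.

Let rhoD x : {morph rho x : u v / u + v}.
Proof. by case: (linear_rules (rho_linear rep x)). Qed.
Let rhoN x : {morph rho x : u / - u}.
Proof. by case: (linear_rules (rho_linear rep x)). Qed.
Let rho1D v x y : rho (x + y) v = rho x v + rho y v.
Proof. by case: (linear_rules (rho_linear1 rep v)). Qed.
Let rho1N v x : rho (- x) v = - rho x v.
Proof. by case: (linear_rules (rho_linear1 rep v)). Qed.
Let rho1_0 v : rho 0 v = 0.
Proof. by case: (linear_rules (rho_linear1 rep v)). Qed.
Let muD x y : {morph mu x y : u v / u + v}.
Proof. by case: (linear_rules (mu_linear rep x y)). Qed.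
Let muN x y : {morph mu x y : u / - u}.
Proof. by case: (linear_rules (mu_linear rep x y)). Qed.

Let linD x y : linear (D x y).
Proof.
move=> a u v; rewrite !DE; move: (mu_linear rep) (rho_linear rep) => lm lr.
rewrite !(lm, lr) !scalerDr !scalerN; vring.
Qed.
Let linD1 y v : linear (fun x => D x y v).
Proof.
move=> a x z; rewrite !DE bra_linearl (mu_linear1 rep) (mu_linear2 rep).
rewrite !(rho_linear1 rep) !(rho_linear rep) !scalerDr !scalerN; vring.
Qed.
Let DD x y : {morph D x y : u v / u + v}.
Proof. by case: (linear_rules (linD x y)). Qed.
Let DN x y : {morph D x y : u / - u}.
Proof. by case: (linear_rules (linD x y)). Qed.
Let Dskew x y v : D x y v = - D y x v.
Proof. by rewrite !DE (bra_skew Lg x y) rho1N; vring. Qed.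
Let linD2 x v : linear (fun y => D x y v).
Proof. by move=> a y z; rewrite !(Dskew x) linD1 scalerN opprD. Qed.

Let bralD v : {morph (fun u => bra Lh u v) : u v / u + v}.
Proof. by case: (linear_rules (bra_linearl Lh v)). Qed.
Let bralN v : {morph (fun u => bra Lh u v) : u / - u}.
Proof. by case: (linear_rules (bra_linearl Lh v)). Qed.
Let brarD u : {morph bra Lh u : u v / u + v}.
Proof. by case: (linear_rules (bra_linearr Lh u)). Qed.
Let brarN u : {morph bra Lh u : u / - u}.
Proof. by case: (linear_rules (bra_linearr Lh u)). Qed.
Let tri1D v w : {morph (fun u => tri Lh u v w) : u v / u + v}.
Proof. by case: (linear_rules (tri_linear1 Lh v w)). Qed.
Let tri1N v w : {morph (fun u => tri Lh u v w) : u / - u}.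
Proof. by case: (linear_rules (tri_linear1 Lh v w)). Qed.
Let tri2D u w : {morph (fun v => tri Lh u v w) : u v / u + v}.
Proof. by case: (linear_rules (tri_linear2 Lh u w)). Qed.
Let tri2N u w : {morph (fun v => tri Lh u v w) : u / - u}.
Proof. by case: (linear_rules (tri_linear2 Lh u w)). Qed.
Let tri3D u v : {morph tri Lh u v : u v / u + v}.
Proof. by case: (linear_rules (tri_linear3 Lh u v)). Qed.
Let tri3N u v : {morph tri Lh u v : u / - u}.
Proof. by case: (linear_rules (tri_linear3 Lh u v)). Qed.

Let linE := (rhoD, rhoN, muD, muN, DD, DN,
  bralD, bralN, brarD, brarN, tri1D, tri1N, tri2D, tri2N, tri3D, tri3N).

Let center0 x : in_center Lh x -> forall y z, ((bra Lh x y = 0) *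
  (bra Lh y x = 0) * (tri Lh x y z = 0) * (tri Lh y x z = 0) *
  (tri Lh y z x = 0))%type.
Proof.
move=> cx y z; have [e1 e2 e3] := cx y z; do !split=> //.
  by rewrite bra_skew e1 oppr0.
by rewrite tri_skew e2 oppr0.
Qed.

Let centerD x y : in_center Lh x -> in_center Lh y -> in_center Lh (x + y).
Proof.
move=> cx cy a b; have ex := center0 cx a b; have ey := center0 cy a b.
by rewrite !linE !ex !ey !addr0.
Qed.
Let centerN x : in_center Lh x -> in_center Lh (- x).
Proof.
by move=> cx a b; have ex := center0 cx a b; rewrite !linE !ex !oppr0.
Qed.

Let cenrho := action_rho_center act.
Let cenmu := action_mu_center act.
Let cenD x y u : in_center Lh (D x y u).
Proof. by rewrite DE; do !(apply: centerD || apply: centerN). Qed.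

Let rho0 x : rho x 0 = 0.
Proof. by case: (linear_rules (rho_linear rep x)). Qed.
Let D_bra x y u v : D x y (bra Lh u v) = 0.
Proof.
by rewrite DE !(action_mu_bra act) !(action_rho_bra act) !rho0 !subr0 addr0.
Qed.
Let D_tri x y u v w : D x y (tri Lh u v w) = 0.
Proof.
by rewrite DE !(action_mu_tri act) !(action_rho_tri act) !rho0 !subr0 addr0.
Qed.

Let rbl x u y : bra Lh (rho x u) y = 0. Proof. by rewrite (center0 (cenrho x u) y 0). Qed.
Let rbr x u y : bra Lh y (rho x u) = 0. Proof. by rewrite (center0 (cenrho x u) y 0). Qed.
Let mbl x z u y : bra Lh (mu x z u) y = 0. Proof. by rewrite (center0 (cenmu x z u) y 0). Qed.
Let mbr x z u y : bra Lh y (mu x z u) = 0. Proof. by rewrite (center0 (cenmu x z u) y 0). Qed.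
Let Dbl x z u y : bra Lh (D x z u) y = 0. Proof. by rewrite (center0 (cenD x z u) y 0). Qed.
Let Dbr x z u y : bra Lh y (D x z u) = 0. Proof. by rewrite (center0 (cenD x z u) y 0). Qed.
Let rt1 x u y z : tri Lh (rho x u) y z = 0. Proof. by rewrite (center0 (cenrho x u) y z). Qed.
Let rt2 x u y z : tri Lh y (rho x u) z = 0. Proof. by rewrite (center0 (cenrho x u) y z). Qed.
Let rt3 x u y z : tri Lh y z (rho x u) = 0. Proof. by rewrite (center0 (cenrho x u) y z). Qed.
Let mt1 x a u y z : tri Lh (mu x a u) y z = 0. Proof. by rewrite (center0 (cenmu x a u) y z). Qed.
Let mt2 x a u y z : tri Lh y (mu x a u) z = 0. Proof. by rewrite (center0 (cenmu x a u) y z). Qed.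
Let mt3 x a u y z : tri Lh y z (mu x a u) = 0. Proof. by rewrite (center0 (cenmu x a u) y z). Qed.
Let Dt1 x a u y z : tri Lh (D x a u) y z = 0. Proof. by rewrite (center0 (cenD x a u) y z). Qed.
Let Dt2 x a u y z : tri Lh y (D x a u) z = 0. Proof. by rewrite (center0 (cenD x a u) y z). Qed.
Let Dt3 x a u y z : tri Lh y z (D x a u) = 0. Proof. by rewrite (center0 (cenD x a u) y z). Qed.

Let act0 := (rbl, rbr, mbl, mbr, Dbl, Dbr, rt1, rt2, rt3, mt1, mt2, mt3,
  Dt1, Dt2, Dt3, action_rho_bra act, action_mu_bra act, D_bra,
  action_rho_tri act, action_mu_tri act, D_tri).

Let mu_bral x y z v : mu (bra Lg x y) z v = mu x z (rho y v) - mu y z (rho x v).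
Proof.
by apply/eqP; rewrite -subr_eq0 -(rep_mu_bral rep x y z v); apply/eqP; vring.
Qed.
Let mu_brar x y z v : mu x (bra Lg y z) v = rho y (mu x z v) - rho z (mu x y v).
Proof.
by apply/eqP; rewrite -subr_eq0 -(rep_mu_brar rep x y z v); apply/eqP; vring.
Qed.
Let D_rho x y z v : D x y (rho z v) = rho (tri Lg x y z) v + rho z (D x y v).
Proof. by rewrite (rep_rho_tri rep) !sealE subrK. Qed.
Let D_mu x y z w v : D x y (mu z w v) =
  mu (tri Lg x y z) w v + mu z (tri Lg x y w) v + mu z w (D x y v).
Proof. by rewrite (rep_mu_D rep) !sealE subrK. Qed.
Let mu_tri x y z w v : mu x (tri Lg y z w) v =
  mu z w (mu x y v) - mu y w (mu x z v) + D y z (mu x w v).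
Proof.
apply/esym/eqP; rewrite -subr_eq0 -(rep_mu_trir rep x y z w v) sealE.
by apply/eqP; vring.
Qed.

Let Dcyc x y z v :
  D (bra Lg x y) z v + D (bra Lg y z) x v + D (bra Lg z x) y v = 0.
Proof.
have j : rho (bra Lg (bra Lg x y) z) v + rho (bra Lg (bra Lg y z) x) v
   + rho (bra Lg (bra Lg z x) y) v + rho (tri Lg x y z) v
   + rho (tri Lg y z x) v + rho (tri Lg z x y) v = 0.
  by rewrite -!rho1D (LY1 Lg) rho1_0.
rewrite -[RHS]oppr0 -j !(rep_rho_tri rep) !sealE !DE !mu_bral !mu_brar !linE.
vring.
Qed.

Let DDcomm x y z w v : D x y (D z w v) =
  D (tri Lg x y z) w v + D z (tri Lg x y w) v + D z w (D x y v).
Proof.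
rewrite [D z w v]DE !linE !D_mu !D_rho (LY3 Lg) rho1D !linE.
rewrite (DE z w (D x y v)) (DE (tri _ _ _ z)) (DE z (tri _ _ _ w)).
vring.
Qed.

Variable T : 'Hom(h, g).
Hypothesis RB : is_relative_rota_baxter1 Lg Lh rho mu T.

Local Notation B := (descent_bra Lh rho T).
Local Notation C := (descent_tri Lg Lh rho mu T).

Let TB u v : T (B u v) = bra Lg (T u) (T v). Proof. by rewrite RB.1. Qed.
Let TC u v w : T (C u v w) = tri Lg (T u) (T v) (T w).
Proof. by rewrite RB.2. Qed.

Let BE u v : B u v = rho (T u) v - rho (T v) u + bra Lh u v. Proof. by []. Qed.
Let CE u v w : C u v w = D (T u) (T v) w + mu (T v) (T w) u - mu (T u) (T w) v
  + tri Lh u v w. Proof. by rewrite -sealE. Qed.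

Let linT : linear T. Proof. by move=> a x y; rewrite linearP. Qed.

Fact descent_bra_linearl v : linear (fun u => B u v).
Proof.
move=> a x y; rewrite !BE linT (rho_linear1 rep) (rho_linear rep) bra_linearl.
rewrite !scalerDr !scalerN; vring.
Qed.

Fact descent_bra_skew u v : B u v = - B v u.
Proof. by rewrite /descent_bra (bra_skew Lh u v); vring. Qed.

Fact descent_bra_linearr u : linear (fun v => B u v).
Proof.
by move=> a v w; rewrite !(descent_bra_skew u) descent_bra_linearl scalerN opprD.
Qed.

Fact descent_tri_skew u v w : C u v w = - C v u w.
Proof. by rewrite !CE (tri_skew Lh u v) (Dskew (T u)); vring. Qed.

Fact descent_tri_linear1 v w : linear (fun u => C u v w).
Proof.
move=> a x y; rewrite !CE linT linD1 (mu_linear rep) (mu_linear1 rep).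
rewrite tri_linear1 !scalerDr !scalerN; vring.
Qed.

Fact descent_tri_linear2 u w : linear (fun v => C u v w).
Proof.
by move=> a x y; rewrite !(descent_tri_skew u) descent_tri_linear1 scalerN opprD.
Qed.

Fact descent_tri_linear3 u v : linear (fun w => C u v w).
Proof.
move=> a x y; rewrite !CE linT linD !(mu_linear2 rep).
rewrite tri_linear3 !scalerDr !scalerN; vring.
Qed.

Let BBE u v w : B (B u v) w = rho (bra Lg (T u) (T v)) w
   - rho (T w) (rho (T u) v) + rho (T w) (rho (T v) u) + bra Lh (bra Lh u v) w.
Proof. by rewrite [LHS]BE TB !BE !linE !act0; vring. Qed.

Let CBE u v w t : C (B u v) w t = D (bra Lg (T u) (T v)) (T w) t
  + mu (T w) (T t) (rho (T u) v) - mu (T w) (T t) (rho (T v) u)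
  - mu (bra Lg (T u) (T v)) (T t) w + tri Lh (bra Lh u v) w t.
Proof. by rewrite [LHS]CE TB !BE !linE !act0; vring. Qed.

Fact descent_LY1 x y z : B (B x y) z + B (B y z) x + B (B z x) y
    + C x y z + C y z x + C z x y = 0.
Proof. by rewrite -(LY1 Lh x y z) !BBE !CE !DE; vring. Qed.

Fact descent_LY2 x y z w : C (B x y) z w + C (B y z) x w + C (B z x) y w = 0.
Proof.
rewrite -(addr0 0) -{1}(Dcyc (T x) (T y) (T z) w) -(LY2 Lh x y z w).
by rewrite !CBE !mu_bral; vring.
Qed.

Fact descent_LY3 x y z w : C x y (B z w) = B (C x y z) w + B z (C x y w).
Proof.
rewrite [LHS]CE TB [B (C x y z) w]BE [B z (C x y w)]BE !TC !BE !CE !linE !act0.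
by rewrite (LY3 Lh) !mu_brar !D_rho; vring.
Qed.

Fact descent_LY4 x y z w t :
  C x y (C z w t) = C (C x y z) w t + C z (C x y w) t + C z w (C x y t).
Proof.
rewrite [LHS]CE TC [C (C x y z) w t]CE [C z (C x y w) t]CE [C z w (C x y t)]CE.
rewrite !TC !CE !linE !act0 (LY4 Lh) DDcomm.
rewrite !(mu_tri _ (T z) (T w) (T t)) !(D_mu (T x) (T y)).
vring.
Qed.

Definition descent : lieYamaguti h :=
  LieYamaguti descent_bra_linearl descent_bra_linearr descent_bra_skew
    descent_tri_linear1 descent_tri_linear2 descent_tri_linear3
    descent_tri_skew descent_LY1 descent_LY2 descent_LY3 descent_LY4.

End Descent.

(* Main.v *)
From HB Require Import structures.
Require Import Defs.
From mathcomp Require Import all_boot all_algebra.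
From mathcomp Require Import ring.

Set Implicit Arguments.
Unset Strict Implicit.
Unset Printing Implicit Defensive.

Import GRing.Theory.
Local Open Scope ring_scope.

(** For a Lie algebra [L] and a subalgebra [H], the quotient space [L / H] is a
    representation of [H]; the same holds for Lie-Yamaguti algebras, because
    the adjoint maps [bra a x] and [tri x a b] satisfy the representation
    axioms ([adjoint_representation]) and preserve [H] when [a, b] lie in [H].

    The proposition is the case where [L] is the semidirect product of [g] and
    [h], that is, the space [g * h] with the brackets
      [(x, u), (y, v)] = ([x, y], rho x v - rho y u + [u, v]),
      [(x, u), (y, v), (z, w)] =
        ([x, y, z], D x y w + mu y z u - mu x z v + [u, v, w]),
    and [H] is the graph of [T]. The Rota-Baxter identities say that
    [u |-> (T u, u)] is a morphism of Lie-Yamaguti algebras from the descent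
    algebra to [L]. The map [(x, u) |-> x - T u] identifies [L / graph T] with
    [g], and it turns the adjoint action of [(T u, u)] into [rhoT], [muT] and
    [DT]: for instance the class of [(T u, u), (x, 0)], whose bracket is
    ([T u, x], - rho x u), is [T u, x] + T (rho x u).
    The passage to the quotient is [representation_descends], applied to a
    surjection instead of a quotient space.

    The identities of the semidirect product need no new computation: [g] acts
    on the direct product of [g] and [h] through [h] alone, the projection to
    [g] is a Rota-Baxter operator of weight 1 for this action, and the
    semidirect product is its descent algebra. *)

(** * Representations *)

Lemma linear_sub (K : fieldType) (U V : vectType K) (f : U -> V) :
  linear f -> {morph f : x y / x - y}.
Proof. by case/linear_rules=> fD fN _ x y; rewrite fD fN. Qed.

Section RepDLinear.
Variables (K : fieldType) (g V : vectType K) (Lg : lieYamaguti g).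
Variables (rho : g -> V -> V) (mu : g -> g -> V -> V).
Hypothesis rep : is_representation Lg rho mu.

Lemma repD_linear x y : linear (repD Lg rho mu x y).
Proof.
have [lr lm] := (rho_linear rep, mu_linear rep).
by move=> a u v; rewrite /repD !(lm, lr) !scalerDr !scalerN; vring.
Qed.

Lemma repD_linear1 y v : linear (fun x => repD Lg rho mu x y v).
Proof.
move=> a x z; rewrite /repD bra_linearl (mu_linear1 rep) (mu_linear2 rep).
by rewrite !(rho_linear1 rep) !(rho_linear rep) !scalerDr !scalerN; vring.
Qed.

End RepDLinear.

Section Adjoint.
Variables (K : fieldType) (g : vectType K) (L : lieYamaguti g).

Definition adjoint_mu (y z x : g) : g := tri L x y z.

(** This is (LY1) for [x], [y], [v]. *)
Lemma repD_adjoint x y v : repD L (bra L) adjoint_mu x y v = tri L x y v.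
Proof.
rewrite /repD /adjoint_mu -[RHS]subr0 -(LY1 L x y v).
rewrite (bra_skew L x (bra L y v)) (bra_skew L y (bra L x v)).
rewrite (bra_skew L v x) (tri_skew L v y x).
have -> : bra L (- bra L x v) y = - bra L (bra L x v) y.
  by case: (linear_rules (bra_linearl L y)).
vring.
Qed.

(** As [repD] is the ternary bracket, the axioms come from (LY2), (LY3) and
    (LY4). The last two say that [tri L x y] is a derivation, and each gives two
    axioms: the vector acted upon is either [x] or an entry of the bracket that
    [tri L x y] is applied to. *)
Lemma adjoint_representation : is_representation L (bra L) adjoint_mu.
Proof.
have tN x y z : tri L (- x) y z = - tri L x y z.
  by case: (linear_rules (tri_linear1 L y z)).
split.
- exact: bra_linearr.
- exact: bra_linearl.
- by move=> x y; apply: tri_linear1.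
- by move=> y v; apply: tri_linear2.
- by move=> x v; apply: tri_linear3.
- move=> x y z v; rewrite /adjoint_mu -[RHS]oppr0 -(LY2 L x y v z).
  by rewrite (tri_skew L v) (bra_skew L v x) tN; vring.
- by move=> x y z v; rewrite /adjoint_mu (LY3 L) (bra_skew L z); vring.
- by move=> x y z v; rewrite !repD_adjoint (LY3 L); vring.
- move=> x y z w v; rewrite repD_adjoint /adjoint_mu (LY4 L v x y z w).
  by rewrite (tri_skew L y (tri L v x z)); vring.
- by move=> x y z w v; rewrite !repD_adjoint /adjoint_mu (LY4 L x y v z w); vring.
Qed.

End Adjoint.

(** Restriction along an algebra morphism [i] and passage to a quotient [p],
    in one step: no action of the smaller algebra on [E] has to be named. *)
Section Descends.
Variables (K : fieldType) (g h E V : vectType K).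
Variables (Lg : lieYamaguti g) (Lh : lieYamaguti h).
Variables (rho : g -> E -> E) (mu : g -> g -> E -> E).
Variables (rho' : h -> V -> V) (mu' : h -> h -> V -> V).
Variables (i : {linear h -> g}) (p : {linear E -> V}).
Hypothesis i_bra : forall u v, i (bra Lh u v) = bra Lg (i u) (i v).
Hypothesis i_tri : forall u v w, i (tri Lh u v w) = tri Lg (i u) (i v) (i w).
Hypothesis p_rho : forall u e, rho' u (p e) = p (rho (i u) e).
Hypothesis p_mu : forall u v e, mu' u v (p e) = p (mu (i u) (i v) e).

Lemma repD_descends u v e :
  repD Lh rho' mu' u v (p e) = p (repD Lg rho mu (i u) (i v) e).
Proof. by rewrite /repD !(p_rho, p_mu) i_bra !(linearD, linearN). Qed.

(** Each axiom at [p e] is the image under [p] of the same axiom at [e]; this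
    reaches every vector because [p] is onto. *)
Lemma representation_descends (s : V -> E) :
  cancel s p -> is_representation Lg rho mu -> is_representation Lh rho' mu'.
Proof.
move=> sK rep.
have pP (P : V -> Prop) : (forall e, P (p e)) -> forall v, P v.
  by move=> Pp v; rewrite -(sK v).
split.
- move=> u a v w; rewrite -(sK v) -(sK w) -linearP !p_rho.
  by rewrite (rho_linear rep) linearP.
- by elim/pP=> e a u v; rewrite !p_rho linearP (rho_linear1 rep) linearP.
- move=> u v a w1 w2; rewrite -(sK w1) -(sK w2) -linearP !p_mu.
  by rewrite (mu_linear rep) linearP.
- by move=> v; elim/pP=> e a u w; rewrite !p_mu linearP (mu_linear1 rep) linearP.
- by move=> v; elim/pP=> e a u w; rewrite !p_mu linearP (mu_linear2 rep) linearP.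
- move=> x y z; elim/pP=> e; rewrite !(p_rho, p_mu) i_bra -linearB -linearD.
  by rewrite (rep_mu_bral rep) linear0.
- move=> x y z; elim/pP=> e; rewrite !(p_rho, p_mu) i_bra -linearB -linearD.
  by rewrite (rep_mu_brar rep) linear0.
- move=> x y z; elim/pP=> e; rewrite !(p_rho, repD_descends) i_tri.
  by rewrite (rep_rho_tri rep) linearB.
- move=> x y z w; elim/pP=> e; rewrite !(p_mu, repD_descends) i_tri.
  by rewrite -!linearB -linearD (rep_mu_trir rep) linear0.
- move=> x y z w; elim/pP=> e; rewrite !(p_mu, repD_descends) !i_tri.
  by rewrite -linearD (rep_mu_D rep) linearB.
Qed.

End Descends.

(** * The semidirect product *)

Section DirectProduct.
Variables (K : fieldType) (g h : vectType K).
Variables (Lg : lieYamaguti g) (Lh : lieYamaguti h).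

Let pbra (a b : g * h) : g * h := (bra Lg a.1 b.1, bra Lh a.2 b.2).
Let ptri (a b c : g * h) : g * h :=
  (tri Lg a.1 b.1 c.1, tri Lh a.2 b.2 c.2).

Definition direct_product : lieYamaguti (g * h)%type.
Proof.
apply: (@LieYamaguti K (g * h)%type pbra ptri).
- by move=> b k a c; congr pair; apply: bra_linearl.
- by move=> b k a c; congr pair; apply: bra_linearr.
- by move=> a b; congr pair; apply: bra_skew.
- by move=> b c k a d; congr pair; apply: tri_linear1.
- by move=> b c k a d; congr pair; apply: tri_linear2.
- by move=> b c k a d; congr pair; apply: tri_linear3.
- by move=> a b c; congr pair; apply: tri_skew.
- by move=> a b c; congr pair; apply: LY1.
- by move=> a b c d; congr pair; apply: LY2.
- by move=> a b c d; congr pair; apply: LY3.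
- by move=> a b c d e; congr pair; apply: LY4.
Defined.

End DirectProduct.

Section SemidirectProduct.
Variables (K : fieldType) (g h : vectType K).
Variables (Lg : lieYamaguti g) (Lh : lieYamaguti h).
Variables (rho : g -> h -> h) (mu : g -> g -> h -> h).
Hypothesis act : is_action Lg Lh rho mu.

Let prho x (a : g * h) : g * h := (0, rho x a.2).
Let pmu x y (a : g * h) : g * h := (0, mu x y a.2).

Let repD_prod x y a : repD Lg prho pmu x y a = (0, repD Lg rho mu x y a.2).
Proof. by congr pair; rewrite /= !subr0 addr0. Qed.

(** On the factor [g] everything acts by zero, so only the second components
    matter, and these repeat the axioms of the given action. *)
Lemma direct_product_action :
  is_action Lg (direct_product Lg Lh) prho pmu.
Proof.
have rep := action_rep act.
have [b0 t0] : (forall y, bra Lg 0 y = 0) * (forall y z, tri Lg 0 y z = 0).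
  split=> [y|y z]; first by case: (linear_rules (bra_linearl Lg y)).
  by case: (linear_rules (tri_linear1 Lg y z)).
have t30 y z : tri Lg y z 0 = 0 by case: (linear_rules (tri_linear3 Lg y z)).
have cen u : in_center Lh u -> in_center (direct_product Lg Lh) (0, u).
  move=> cu a b; have [e1 e2 e3] := cu a.2 b.2.
  by split; congr pair; rewrite /= ?(b0, t0, t30).
split.
- split.
  + by move=> x k a b; congr pair; rewrite /= ?scaler0 ?addr0 // (rho_linear rep).
  + by move=> a k x y; congr pair; rewrite /= ?scaler0 ?addr0 // (rho_linear1 rep).
  + by move=> x y k a b; congr pair; rewrite /= ?scaler0 ?addr0 // (mu_linear rep).
  + by move=> y a k x z; congr pair; rewrite /= ?scaler0 ?addr0 // (mu_linear1 rep).
  + by move=> x a k y z; congr pair; rewrite /= ?scaler0 ?addr0 // (mu_linear2 rep).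
  + by move=> x y z a; congr pair; [rewrite /= subr0 addr0 | apply: rep_mu_bral rep _ _ _ _].
  + by move=> x y z a; congr pair; [rewrite /= subr0 addr0 | apply: rep_mu_brar rep _ _ _ _].
  + move=> x y z a; rewrite !repD_prod.
    by congr pair; [rewrite /= subr0 | apply: rep_rho_tri rep _ _ _ _].
  + move=> x y z w a; rewrite !repD_prod.
    by congr pair; [rewrite /= !subr0 addr0 | apply: rep_mu_trir rep _ _ _ _ _].
  + move=> x y z w a; rewrite !repD_prod.
    by congr pair; [rewrite /= subr0 addr0 | apply: rep_mu_D rep _ _ _ _ _].
- by move=> x a; apply/cen/(action_rho_center act).
- by move=> x y a; apply/cen/(action_mu_center act).
- by move=> x a b; congr pair; apply: action_rho_bra act _ _ _.
- by move=> x y a b; congr pair; apply: action_mu_bra act _ _ _ _.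
- by move=> x a b c; congr pair; apply: action_rho_tri act _ _ _ _.
- by move=> x y a b c; congr pair; apply: action_mu_tri act _ _ _ _ _.
Qed.

Let pr1 : 'Hom((g * h)%type, g) := linfun fst.

(** In the first component of the descent brackets all terms with [prho] and
    [pmu] vanish, so both sides are the brackets of [g]. *)
Lemma projection_rota_baxter :
  is_relative_rota_baxter1 Lg (direct_product Lg Lh) prho pmu pr1.
Proof.
split=> [a b|a b c]; first by rewrite !lfunE /= subr0 add0r.
by rewrite /descent_tri repD_prod !lfunE /= !subr0 !add0r.
Qed.

Definition semidirect_product : lieYamaguti (g * h)%type :=
  descent direct_product_action projection_rota_baxter.

Lemma semidirect_braE a b : bra semidirect_product a b =
  (bra Lg a.1 b.1, rho a.1 b.2 - rho b.1 a.2 + bra Lh a.2 b.2).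
Proof.
by rewrite /= /descent_bra !lfunE; congr pair; rewrite /= subr0 add0r.
Qed.

Lemma semidirect_triE a b c : tri semidirect_product a b c =
  (tri Lg a.1 b.1 c.1,
   repD Lg rho mu a.1 b.1 c.2 + mu b.1 c.1 a.2 - mu a.1 c.1 b.2
   + tri Lh a.2 b.2 c.2).
Proof.
rewrite /= /descent_tri repD_prod !lfunE.
by congr pair; rewrite /= subr0 !add0r.
Qed.

End SemidirectProduct.

(** * The quotient by the graph of the operator *)

Section Graph.
Variables (K : fieldType) (g h : vectType K) (T : 'Hom(h, g)).

Definition graph_map (u : h) : g * h := (T u, u).

(** The kernel is the graph of [T], so this is the quotient map, with
    [x |-> (x, 0)] as a section. *)
Definition mod_graph (a : g * h) : g := a.1 - T a.2.

Fact graph_map_linear : linear graph_map.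
Proof. by move=> k u v; congr pair; rewrite linearP. Qed.

Fact mod_graph_linear : linear mod_graph.
Proof.
by move=> k a b; rewrite /mod_graph /= linearP scalerBr opprD addrACA.
Qed.

HB.instance Definition _ :=
  GRing.isLinear.Build K h (g * h)%type _ graph_map graph_map_linear.
HB.instance Definition _ :=
  GRing.isLinear.Build K (g * h)%type g _ mod_graph mod_graph_linear.

Lemma mod_graphK : cancel (fun x => (x, 0)) mod_graph.
Proof. by move=> x; rewrite /mod_graph linear0 subr0. Qed.

Variables (Lg : lieYamaguti g) (Lh : lieYamaguti h).
Variables (rho : g -> h -> h) (mu : g -> g -> h -> h).
Hypothesis act : is_action Lg Lh rho mu.
Hypothesis RB : is_relative_rota_baxter1 Lg Lh rho mu T.

Local Notation L := (semidirect_product act).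
Local Notation H := (descent act RB).

(** The Rota-Baxter identities are the first components of this and the next
    equality; the second components hold by definition of the descent. *)
Lemma graph_map_bra u v :
  graph_map (bra H u v) = bra L (graph_map u) (graph_map v).
Proof. by rewrite semidirect_braE /graph_map /= RB.1. Qed.

Lemma graph_map_tri u v w :
  graph_map (tri H u v w) = tri L (graph_map u) (graph_map v) (graph_map w).
Proof. by rewrite semidirect_triE /graph_map /= RB.2. Qed.

Let rep := action_rep act.
Let TD : {morph T : u v / u + v}. Proof. exact: linearD. Qed.
Let TN : {morph T : u / - u}. Proof. exact: linearN. Qed.

(** For [a = (x, w)] with [w = 0] this is the definition of [rhoT]; the terms
    in [w] cancel because the graph is closed under brackets. *)
Lemma mod_graph_rhoT u a :
  rhoT Lg rho T u (mod_graph a) = mod_graph (bra L (graph_map u) a).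
Proof.
rewrite semidirect_braE /mod_graph /rhoT /=.
rewrite (linear_sub (bra_linearr Lg _)) (linear_sub (rho_linear1 rep _)) RB.1.
by rewrite !(TD, TN); vring.
Qed.

Lemma mod_graph_muT u v a : muT Lg rho mu T u v (mod_graph a) =
  mod_graph (adjoint_mu L (graph_map u) (graph_map v) a).
Proof.
rewrite /adjoint_mu semidirect_triE /mod_graph /muT /=.
rewrite (linear_sub (tri_linear1 Lg _ _)) (linear_sub (mu_linear1 rep _ _)).
rewrite (linear_sub (repD_linear1 rep _ _)) RB.2.
by rewrite !(TD, TN); vring.
Qed.

Lemma mod_graph_DT u v x : DT Lg mu T u v x =
  mod_graph (tri L (graph_map u) (graph_map v) (x, 0)).
Proof.
rewrite semidirect_triE /mod_graph /DT /=.
have [_ _ ->] := linear_rules (repD_linear rep (T u) (T v)).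
by have [_ _ ->] := linear_rules (tri_linear3 Lh u v); rewrite add0r addr0.
Qed.

End Graph.

Theorem proposition5p2 (K : fieldType) (charK0 : [pchar K] =i pred0)
    (g h : vectType K) (Lg : lieYamaguti g) (Lh : lieYamaguti h)
    (rho : g -> h -> h) (mu : g -> g -> h -> h)
    (act : is_action Lg Lh rho mu) (T : 'Hom(h, g))
    (RB : is_relative_rota_baxter1 Lg Lh rho mu T) :
  is_representation (descent act RB) (rhoT Lg rho T) (muT Lg rho mu T) /\
  (forall (u v : h) (x : g),
     repD (descent act RB) (rhoT Lg rho T) (muT Lg rho mu T) u v x
     = DT Lg mu T u v x).
Proof.
have i_bra := graph_map_bra act RB; have p_rho := mod_graph_rhoT act RB.
have p_mu := mod_graph_muT act RB; split.
  apply: (representation_descends i_bra (graph_map_tri act RB) p_rho p_mu).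
    exact: mod_graphK.
  exact: adjoint_representation.
move=> u v x; rewrite (mod_graph_DT T act) -repD_adjoint.
by rewrite -(repD_descends i_bra p_rho p_mu) /= mod_graphK.
Qed.
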